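(* Let $p$ and $q$ be primes and let $(P,\alpha)$ be a maximal $(p,q)$-pair of rank $2$. Assume that $p>3$. Then $P$ is isomorphic to one of the following: (1) an elementary abelian group of order $p^2$; (2) an extraspecial group of order $p^3$ and exponent $p$.
   Context: For a finite group $G$, $\mathrm{d}(G)$ denotes the minimum number of generators of $G$ and $\Phi(G)$ its Frattini subgroup. A power automorphism of a finite group is an automorphism sending every subgroup to itself. Let $p,q$ be primes. A maximal $(p,q)$-pair of rank $d$ is a pair $(P,\alpha)$ where $P$ is a finite $p$-group, $\alpha\in\mathrm{Aut}(P)$ has prime order $q$ dividing $p-1$, and: (a) the minimal number of generators of every subgroup of $P$ is at most $\mathrm{d}(P)=d$; (b) the image of $\alpha$ in $\mathrm{Aut}(P/\Phi(P))$ is a non-trivial power automorphism; (c) if $H$ is a proper subgroup of $P$ with $\mathrm{d}(H)=\mathrm{d}(P)$, then either $\alpha(H)\neq H$ or the image of $\alpha$ in $\mathrm{Aut}(H/\Phi(H))$ is not a non-trivial power automorphism. *)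

(* Defs.v *)
From mathcomp Require Import all_boot all_fingroup all_solvable.

Set Implicit Arguments.
Unset Strict Implicit.
Unset Printing Implicit Defensive.

Local Open Scope group_scope.

Definition power_automorphism (gT : finGroupType) (G : {group gT})
    (b : {perm gT}) : Prop :=
  b \in Aut G /\ forall K : {group gT}, K \subset G -> b @: K = K.

(* The image in Aut (H / 'Phi(H)) of the restriction to H of a. It is
   meaningful only when a restricts to an automorphism of H
   (see frattini_autE): restr_perm H a is 1 when a does not stabilise H. *)
Definition frattini_aut (gT : finGroupType) (H : {group gT}) (a : {perm gT}) :
    {perm coset_of 'Phi(H)} :=
  actperm ([Aut H] / 'Phi(H))%gact (restr_perm H a).

Lemma frattini_autE (gT : finGroupType) (P H : {group gT}) (a : {perm gT}) :
    a \in Aut P -> H \subset P -> a @: H = H ->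
  frattini_aut H a \in Aut (H / 'Phi(H)) /\
  forall x, x \in H -> frattini_aut H a (coset 'Phi(H) x) = coset 'Phi(H) (a x).
Proof.
move=> AutPa sHP aH.
have nHa: a \in 'N(H | 'P).
  by rewrite !inE /=; apply/subsetP=> x Hx; rewrite inE /= apermE -aH imset_f.
have AutHa: restr_perm H a \in Aut H by exact: Aut_restr_perm sHP _ AutPa.
have Da: restr_perm H a \in qact_dom [Aut H] 'Phi(H).
  rewrite qact_domE ?Phi_sub // !(AutHa, inE) /=; apply/subsetP=> x Phx.
  have /andP[_ /forall_inP/(_ _ AutHa)/subsetP] := Phi_char H.
  by rewrite inE; apply; apply: (imset_f (restr_perm H a)).
split; first exact: actperm_Aut.
move=> x Hx; have Nx := subsetP (normal_norm (Phi_normal H)) x Hx.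
by rewrite actpermE qactE //; congr coset; apply: restr_permE.
Qed.

Record maximal_pair (gT : finGroupType) (p q d : nat) (P : {group gT})
    (a : {perm gT}) : Prop := MaximalPair {
  maximal_pair_pgroup : p.-group P;
  maximal_pair_aut : a \in Aut P;
  maximal_pair_order : #[a] = q;
  maximal_pair_dvd : q %| p.-1;
  maximal_pair_rank : 'm(P) = d;
  maximal_pair_sub : forall H : {group gT}, H \subset P -> 'm(H) <= d;
  maximal_pair_power : power_automorphism (P / 'Phi(P)) (frattini_aut P a);
  maximal_pair_nontriv : frattini_aut P a != 1;
  maximal_pair_max : forall H : {group gT}, H \proper P -> 'm(H) = 'm(P) ->
    a @: H <> H \/
    ~ (power_automorphism (H / 'Phi(H)) (frattini_aut H a)
       /\ frattini_aut H a != 1)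
}.

(* Main.v *)
Require Import Defs.
From mathcomp Require Import all_boot all_fingroup all_solvable.
From mathcomp Require Import zify.

(* Let U be the subgroup generated by the p-th powers of P and let l <> 1 (mod p) be the
   scalar by which alpha acts on P / 'Phi(P). The engine is a descent for eigenvectors, that
   is, elements sent by alpha to their n-th power for a fixed n <> 1 (mod p): by maximality,
   two of them generate P or a cyclic group. So if x, y are eigenvectors generating P, then
   x ^+ p and y ^+ p generate the same central subgroup. If [P, P, P] <= U, then, as p > 3, the
   p-th power map is a homomorphism modulo W = [U, P] U^p, and an eigenvector of the form
   y^j x y^j has trivial p-th power modulo W; hence U = W and U = 1.
   - If [P, P] <= U, comparing the eigenvalues l on p-powers and l ^ 2 on commutators shows
     that P is abelian; then alpha is a power map and every element is an eigenvector.
   - Otherwise P / U is extraspecial of order p ^ 3. If U <> 1, then some [x, y, z] is not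
     in W, and comparing the eigenvalues l ^ 3 and l on U / W yields l = -1 (mod p). Thus
     q = 2 and the elements inverted by alpha, which are closed under (x, y) |-> y x y,
     generate P. *)

Set Implicit Arguments.
Unset Strict Implicit.
Unset Printing Implicit Defensive.

Local Open Scope group_scope.

(** * Power maps in class 3, and power automorphisms of elementary abelian groups *)

Section Powers.

Variable gT : finGroupType.
Implicit Types (G H U W : {group gT}) (x y z : gT).

(* Hall's collection formula in class 3. *)
Lemma expMg_class3 n x y (c := [~ y, x]) (d := [~ c, x]) (e := [~ c, y]) :
    commute d x -> commute d y -> commute e x -> commute e y ->
  (x * y) ^+ n = x ^+ n * y ^+ n * c ^+ 'C(n, 2) * d ^+ 'C(n, 3)
                 * e ^+ ('C(n, 2) + 2 * 'C(n, 3)).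
Proof.
move=> cdx cdy cex cey.
have com_c z : commute z x -> commute z y -> commute z c.
  by move=> zx zy; do !apply: commuteM => //; apply: commuteV.
have cdc := com_c d cdx cdy; have cec := com_c e cex cey.
have cx k : c ^+ k * x = x * c ^+ k * d ^+ k.
  rewrite commgC commXg //; exact: commute_sym.
have cy k : c ^+ k * y = y * c ^+ k * e ^+ k.
  rewrite commgC commXg //; exact: commute_sym.
have ynx k : y ^+ k * x = x * y ^+ k * c ^+ k * e ^+ 'C(k, 2).
  have -> : y ^+ k * x = x * (y ^+ k) ^ x by rewrite -conjgC.
  rewrite conjXg (_ : y ^ x = y * c); last by rewrite /c conjg_mulR.
  rewrite expMg_Rmul -/e ?mulgA //; exact: commute_sym.
elim: n => [|n IHn]; first by rewrite !bin0n !mulg1.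
have cX (a b : gT) (k l : nat) : commute a b -> a ^+ k * b ^+ l = b ^+ l * a ^+ k.
  by move=> cab; apply/commuteX2.
have cX1 (a b : gT) (k : nat) : commute a b -> a ^+ k * b = b * a ^+ k.
  by move=> cab; apply/commute_sym/commuteX/commute_sym.
rewrite expgSr IHn !binS !bin1.
set m := 'C(n, 2); set t := 'C(n, 3).
rewrite -!mulgA.
(* The last [x] and [y] travel left: crossing [c ^+ m] they leave [d ^+ m] and [e ^+ m]; [x]
   crossing [y ^+ n] leaves [c ^+ n] and [e ^+ m], and [y] crossing that [c ^+ n] leaves
   [e ^+ n]. *)
rewrite (mulgA (e ^+ _) x) (cX1 _ _ _ cex) -!mulgA (cX1 _ _ _ cey).
rewrite (mulgA (d ^+ _) x) (cX1 _ _ _ cdx) -!mulgA (mulgA (d ^+ _) y) (cX1 _ _ _ cdy).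
rewrite (mulgA (c ^+ _) x) cx -!mulgA (mulgA (d ^+ m) y) (cX1 _ _ _ cdy) -!mulgA.
rewrite (mulgA (c ^+ _) y) cy -!mulgA (mulgA (y ^+ n) x) ynx -!mulgA.
rewrite (mulgA (e ^+ 'C(n, 2)) y) (cX1 _ _ _ cey) -!mulgA.
rewrite (mulgA (c ^+ n) y) cy -!mulgA.
rewrite [in RHS]expgSr [y ^+ n.+1]expgSr -!mulgA; congr (_ * (_ * (_ * (_ * _)))).
have ced : commute e d.
  by rewrite /d; do !apply: commuteM => //; apply: commuteV.
rewrite -/m.
rewrite (mulgA (e ^+ m) (c ^+ m)) (cX _ _ _ _ cec) -!mulgA.
rewrite (mulgA (e ^+ n) (c ^+ m)) (cX _ _ _ _ cec) -!mulgA.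
rewrite (mulgA (c ^+ n)) -expgD (addnC n m); congr (_ * _).
have eD (a z : gT) (k l : nat) : a ^+ k * (a ^+ l * z) = a ^+ (k + l) * z.
  by rewrite expgD mulgA.
by rewrite !eD mulgA (cX _ _ _ _ ced) -mulgA -expgD; congr (_ ^+ _ * _ ^+ _); lia.
Qed.

Section PowerEndomorphism.

Variables (p : nat) (G V : {group gT}).
Hypotheses (pr_p : prime p) (p_gt3 : 3 < p) (sVZ : V \subset 'Z(G)).
Hypotheses (expV : {in V, forall v, v ^+ p = 1}).
Hypotheses (expG : {in G, forall x, x ^+ p \in V}).
Hypotheses (class3 : {in G & &, forall x y z, [~ x, y, z] \in V}).

(** For p > 3 both C(p, 2) and C(p, 3) are multiples of p, so the correction terms of the class 3
    formula vanish once the commutator itself has p-th power 1. *)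
Lemma expMg_pclass3 : {in G &, {morph (fun x => x ^+ p) : x y / x * y}}.
Proof.
move=> x y Gx Gy /=.
have comV (v z : gT) : v \in V -> z \in G -> commute v z.
  by move=> /(subsetP sVZ)/centerP[_ cvG] /cvG.
have Vd := class3 Gy Gx Gx; have Ve := class3 Gy Gx Gy.
have dvdX (v : gT) k : v ^+ p = 1 -> p %| k -> v ^+ k = 1.
  by move=> vp /dvdnP[m ->]; rewrite mulnC expgM vp expg1n.
have p2 : p %| 'C(p, 2) by rewrite prime_dvd_bin //= (ltn_trans _ p_gt3).
have p3 : p %| 'C(p, 3) by rewrite prime_dvd_bin.
(* With c = [~ y, x] and e = [~ c, y], the central element y^p equals its conjugate (y c)^p = y^p
   c^p e^C(p, 2), whose last factor is 1. *)
have cp1 : [~ y, x] ^+ p = 1.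
  apply: (mulgI (y ^+ p)); rewrite mulg1.
  have yx : (y ^+ p) ^ x = y ^+ p by rewrite conjgE (comV _ x) ?expG // mulKg.
  have := expMg_Rmul p (commute_sym (comV _ _ Ve (groupR Gy Gx))) (commute_sym (comV _ _ Ve Gy)).
  by rewrite -conjg_mulR -conjXg yx (dvdX _ _ (expV Ve)) // mulg1 => <-.
rewrite expMg_class3; do 1?exact: comV.
by rewrite !(dvdX _ _ cp1, dvdX _ _ (expV Vd), dvdX _ _ (expV Ve)) ?mulg1 // dvdn_add ?dvdn_mull.
Qed.

End PowerEndomorphism.

(** One non-trivial [x] dictates the exponent: for [y] outside [<[x]>], comparing [b (x * y)] with
    [b x * b y] in the direct product of the two cycles equates the exponents mod p. *)
Lemma power_aut_abelem p (E : {group gT}) (b : {perm gT}) :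
    p.-abelem E -> power_automorphism E b ->
  exists l, {in E, forall y, b y = y ^+ l}.
Proof.
move=> abelE [AutEb bK].
have [E1 | /trivgPn[x Ex ntx]] := eqVneq (E : {set gT}) 1.
  by exists 0 => y; rewrite E1 => /set1P->; rewrite -(autmE AutEb) morph1.
have oE (y : gT) : y \in E -> y != 1 -> #[y] = p by move/(abelem_order_p abelE); apply.
have [pr_p _ _] : [/\ prime p, p %| #|E| & exists m, #|E| = (p ^ m.+1)%N].
  by apply: pgroup_pdiv (abelem_pgroup abelE) _; apply/trivgPn; exists x.
have bX (y : gT) : y \in E -> exists k, b y = y ^+ k.
  move=> Ey; apply/cycleP; have := imset_f b (cycle_id y).
  by rewrite (bK <[y]>%G) // cycle_subG.
have [l bx] := bX x Ex; exists l => y Ey; rewrite -(autmE AutEb).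
have [/cycleP[k ->] | x'y] := boolP (y \in <[x]>).
  by rewrite morphX //= autmE bx -!expgM mulnC.
have nty : y != 1 by apply: contraNneq x'y => ->; apply: group1.
have tixy : <[x]> :&: <[y]> = 1.
  by rewrite setIC prime_TIg ?cycle_subG // -orderE oE.
have [k bxy] := bX _ (groupM Ex Ey); have [j by_] := bX y Ey.
have cxy : commute x y by apply: (centsP (abelem_abelian abelE)).
move: bxy; rewrite -(autmE AutEb) morphM //= !autmE bx by_ expgMn // => bxy.
have exy : (x ^+ k)^-1 * x ^+ l = y ^+ k * (y ^+ j)^-1.
  apply: (mulgI (x ^+ k)); rewrite mulKVg; apply: (mulIg (y ^+ j)).
  by rewrite -!mulgA mulVg mulg1.
have /set1gP x1 : (x ^+ k)^-1 * x ^+ l \in [1 gT].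
  rewrite -tixy inE {2}exy !(groupM, groupV, mem_cycle) //.
move/eqP: exy; rewrite x1 eq_sym -eq_mulgV1 => /eqP <-.
move/eqP: x1; rewrite -eq_mulVg1 => /eqP/eqP.
by rewrite !eq_expg_mod_order => exy; apply/eqP; rewrite eq_expg_mod_order !oE // in exy *.
Qed.

Lemma cyclic_grank_le1 (G : {group gT}) : 'm(G) <= 1 -> cyclic G.
Proof.
have [B <- <-] := grank_witness G; rewrite leq_eqVlt => /orP[/cards1P[x ->]|].
  exact: cycle_cyclic.
by rewrite ltnS leqn0 cards_eq0 => /eqP->; rewrite gen0 cyclic1.
Qed.
End Powers.

(** * Eigenvectors of a maximal pair and the scalar on its Frattini quotient *)

Section MaximalPair.

Variables (p q : nat) (gT : finGroupType) (P : {group gT}) (a : {perm gT}).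
Hypotheses (pr_p : prime p) (pr_q : prime q) (maxP : maximal_pair p q 2 P a).
Hypothesis p_gt3 : 3 < p.

Let pP : p.-group P := maximal_pair_pgroup maxP.
Let AutPa : a \in Aut P := maximal_pair_aut maxP.

Lemma pair_autM : {in P &, {morph a : x y / x * y}}.
Proof. by move=> x y Px Py; rewrite -(autmE AutPa) morphM. Qed.

Lemma pair_autX n : {in P, {morph a : x / x ^+ n}}.
Proof. by move=> x Px; rewrite -(autmE AutPa) morphX. Qed.

Lemma pair_autV : {in P, {morph a : x / x^-1}}.
Proof. by move=> x Px; rewrite -(autmE AutPa) morphV. Qed.

Lemma pair_autR : {in P &, {morph a : x y / [~ x, y]}}.
Proof. by move=> x y Px Py; rewrite -(autmE AutPa) morphR. Qed.

Lemma pair_aut_char (H : {group gT}) x : H \char P -> x \in H -> a x \in H.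
Proof.
move=> /charP[sHP chH] Hx; rewrite -(autmE AutPa) /=.
have /setP <- := chH _ (injm_autm AutPa) (im_autm AutPa).
by rewrite mem_morphim // (subsetP sHP).
Qed.

Lemma pair_aut_closed x : x \in P -> a x \in P.
Proof. exact: (pair_aut_char (char_refl P)). Qed.

Lemma pair_not_cyclic : ~~ cyclic P.
Proof.
apply/negP=> /cyclicP[x defP]; have := maximal_pair_rank maxP.
by rewrite defP -[<[x]>]/<<[set x]>> => m2; have := grank_min [set x]; rewrite m2 cards1.
Qed.

Lemma card_quotient_Phi_le (H : {group gT}) :
  H \subset P -> #|H / 'Phi(H)| <= p ^ 2.
Proof.
move=> sHP; have pH := pgroupS sHP pP.
have abE := Phi_quotient_abelem pH.
rewrite (card_pgroup (abelem_pgroup abE)) leq_exp2l ?prime_gt1 //.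
rewrite -(rank_abelem abE) -grank_abelian ?(abelem_abelian abE) //.
by rewrite (leq_trans (quotient_grank (gFnorm _ _)) (maximal_pair_sub maxP sHP)).
Qed.

(** This is how maximality is used: the subgroup [H] generated by [u] and [v] is stable under [a],
    which acts on its Frattini quotient as the n-th power. If [H] is proper with two generators
    needed, condition (c) is violated. *)
Lemma eigen_gen2 n u v :
    u \in P -> v \in P -> a u = u ^+ n -> a v = v ^+ n -> n != 1 %[mod p] ->
  <<[set u; v]>> = P \/ cyclic <<[set u; v]>>.
Proof.
move=> Pu Pv au av n1; pose H := <<[set u; v]>>%G.
rewrite -[<<_>>]/(gval H).
have sHP : H \subset P by rewrite gen_subG subUset !sub1set Pu Pv.
have pH := pgroupS sHP pP.
have [-> | neHP] := eqVneq (H : {set gT}) P; [by left | right].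
apply: cyclic_grank_le1; rewrite -ltnS ltn_neqAle.
have -> : 'm(H) <= 2 by apply: leq_trans (grank_min _) _; rewrite cards2; case: (_ != _).
rewrite andbT; apply/negP=> /eqP mH.
have ltHP : H \proper P by rewrite properEneq neHP.
have aS (S : {group coset_of 'Phi(H)}) (b : {perm _}) :
    {in S, forall z, b z \in S} -> b @: S = S.
  move=> bS; apply/eqP; rewrite eqEcard card_imset ?leqnn ?andbT; last exact: perm_inj.
  by apply/subsetP=> _ /imsetP[z Sz ->]; apply: bS.
have aH : a @: H = H.
  apply/eqP; rewrite eqEcard card_imset ?leqnn ?andbT; last exact: perm_inj.
  rewrite -(autmE AutPa) -morphimEsub //= morphim_gen ?(subset_trans (subset_gen _) sHP) //.
  rewrite gen_subG; apply/subsetP=> _ /morphimP[z Pz /set2P[]-> ->] /=.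
    by rewrite autmE au groupX // mem_gen ?set21.
  by rewrite autmE av groupX // mem_gen ?set22.
have [/(_ aH)// | []] := maximal_pair_max maxP ltHP (etrans mH (esym (maximal_pair_rank maxP))).
have [Autb bE] := frattini_autE AutPa sHP aH; set b := frattini_aut H a in Autb bE *.
have abE := Phi_quotient_abelem pH.
(* Both [b] and the n-th power map are endomorphisms of this abelian quotient, so it is enough that
   they agree on the images of [u] and [v]. *)
have bX : {in H / 'Phi(H), forall z, b z = z ^+ n}.
  pose S := [set z in H / 'Phi(H) | b z == z ^+ n].
  have gS : group_set S.
    apply/group_setP; split=> [|y z].
      by rewrite inE group1 expg1n -(autmE Autb) morph1 eqxx.
    rewrite !inE => /andP[Hy /eqP by_] /andP[Hz /eqP bz].
    rewrite groupM // -(autmE Autb) morphM //= autmE by_ bz expgMn //.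
    exact: (centsP (abelem_abelian abE)).
  have : H / 'Phi(H) \subset Group gS.
    rewrite quotient_gen ?gen_subG; last first.
      by rewrite (subset_trans (subset_gen _)) // gFnorm.
    apply/subsetP=> _ /morphimP[x Nx Hx ->]; rewrite inE.
    have Hx' : x \in H by apply: mem_gen.
    rewrite mem_quotient //= bE // -morphX //.
    by case/set2P: Hx => ->; rewrite ?au ?av.
  by move=> sS z /(subsetP sS); rewrite inE => /andP[_ /eqP].
split.
  split=> // K sK; apply: aS => z Kz; rewrite bX ?groupX //; exact: (subsetP sK).
have ntH : H / 'Phi(H) != 1.
  apply/negP=> /eqP H1; move: mH; have := grank_min (set0 : {set gT}).
  rewrite cards0 gen0; suff -> : H = 1%G by move=> le0 m2; rewrite m2 in le0.
  apply/eqP; apply: contraT => /Phi_proper/proper_subn/negP[].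
  by rewrite -quotient_sub1 ?H1 ?gFnorm.
have [z Ez ntz] := trivgPn _ ntH; apply: contra n1 => /eqP b1.
have := bX z Ez; rewrite b1 perm1 -{1}[z]expg1 => /eqP.
by rewrite eq_expg_mod_order (abelem_order_p abE) // eq_sym.
Qed.

(** The induced power automorphism is a scalar [l], not 1 by non-triviality. Since [a] has order q,
    l^q = 1 mod p, which also makes [l] prime to p. *)
Lemma pair_scalar : exists l : nat,
  [/\ l != 1 %[mod p], {in P, forall x, coset 'Phi(P) (a x) = coset 'Phi(P) x ^+ l},
      l ^ q = 1 %[mod p] & coprime p l].
Proof.
have [l bl] := power_aut_abelem (Phi_quotient_abelem pP) (maximal_pair_power maxP).
have aP : a @: P = P.
  by rewrite -(autmE AutPa) -morphimEdom /= im_autm.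
have [Autb bE] := frattini_autE AutPa (subxx P) aP.
have abE := Phi_quotient_abelem pP.
have al : {in P, forall x, coset 'Phi(P) (a x) = coset 'Phi(P) x ^+ l}.
  by move=> x Px; rewrite -bE ?bl // mem_quotient.
have aiter n : {in P, forall x, (a ^+ n) x \in P /\
    coset 'Phi(P) ((a ^+ n) x) = coset 'Phi(P) x ^+ (l ^ n)}.
  move=> x Px; elim: n => [|n [Py IH]]; first by rewrite perm1.
  by rewrite expgSr permM pair_aut_closed // al // IH -expgM expnSr.
have /trivgPn[z Ez ntz] : P / 'Phi(P) != 1.
  apply: contra (pair_not_cyclic) => /eqP P1; apply: Phi_quotient_cyclic.
  by rewrite P1 cyclic1.
have oz := abelem_order_p abE Ez ntz.
have lq : l ^ q = 1 %[mod p].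
  apply/eqP; rewrite -oz -eq_expg_mod_order.
  case/morphimP: Ez => x Nx Px ->; have [_ <-] := aiter q x Px.
  by rewrite -(maximal_pair_order maxP) expg_order perm1.
exists l; split=> //.
  apply: contra (maximal_pair_nontriv maxP) => l1; apply/eqP.
  apply: (eq_Aut Autb (group1 _)) => y Ey; rewrite bl // perm1 -[RHS]expg1.
  have [-> | nty] := eqVneq y 1; first by rewrite !expg1n.
  by apply/eqP; rewrite eq_expg_mod_order (abelem_order_p abE).
rewrite prime_coprime //; apply/negP=> /dvdnP[m lE]; move/eqP: lq.
by rewrite -(prednK (prime_gt0 pr_q)) expnS lE -!mulnA mulnCA modnMr modn_small ?prime_gt1.
Qed.

End MaximalPair.

(** * The p-th power map modulo a central layer *)

Section PowerSeries.

Variables (p : nat) (gT : finGroupType) (P : {group gT}).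
Hypotheses (pr_p : prime p) (p_gt3 : 3 < p) (pP : p.-group P).

Section CentralQuotient.

Variable H : {group gT}.
Hypothesis chHP : H \char P.

(* The least normal subgroup of P modulo which H is central of exponent p. *)
Definition pcen := [~: H, P] <*> 'Mho^1(H).
Canonical pcen_group := Eval hnf in [group of pcen].

Lemma pcen_char : pcen \char P.
Proof.
by rewrite charY ?charR ?char_refl // (char_trans (Mho_char _ _) chHP).
Qed.

Lemma pcen_normal : pcen <| P. Proof. exact: char_normal pcen_char. Qed.

Lemma pcen_sub : pcen \subset H.
Proof. by rewrite join_subG Mho_sub commg_subl char_norm. Qed.

(** The p-th powers of [H] lie in ['Phi(H)], so H = [H, P] H^p already gives H = [H, P], which is
    impossible for a non-trivial subgroup of a nilpotent group. *)
Lemma sub_pcen_trivial : H \subset pcen -> H :=: 1.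
Proof.
move=> sHW; have pH := pgroupS (char_sub chHP) pP.
have defH : [~: H, P] = H.
  rewrite -[LHS]genGid; apply: Phi_nongen; apply/eqP.
  rewrite eqEsubset join_subG Phi_sub commg_subl char_norm //= (subset_trans sHW) //.
  by rewrite /pcen joingC genS // setSU // (Phi_joing pH) joing_subr.
apply/eqP; have /forall_inP := pgroup_nil pP; apply.
by rewrite subsetI char_sub /= ?defH.
Qed.

Lemma pcen_cent : H / pcen \subset 'Z(P / pcen).
Proof.
rewrite subsetI (quotientS _ (char_sub chHP)) quotient_cents2r //.
exact: joing_subl.
Qed.

Lemma pcen_exp : {in H / pcen, forall v, v ^+ p = 1}.
Proof.
move=> _ /morphimP[u Nu Hu ->]; rewrite -morphX //= coset_id // mem_gen //.
by rewrite inE -[p]expn1 Mho_p_elt ?orbT // (mem_p_elt (pgroupS (char_sub chHP) pP)).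
Qed.

End CentralQuotient.

Local Notation U := 'Mho^1(P).
Local Notation W := (pcen 'Mho^1(P)).

Let chU : U \char P := Mho_char 1 P.

Lemma pow_Mho1 x : x \in P -> x ^+ p \in U.
Proof. by move=> Px; rewrite -[p]expn1 Mho_p_elt // (mem_p_elt pP). Qed.

Lemma Mho1_sub_Phi : U \subset 'Phi(P).
Proof. by rewrite (Phi_joing pP) joing_subr. Qed.

Lemma Mho1_quotient_sub (K : {group coset_of W}) :
  {in P, forall x, coset W (x ^+ p) \in K} -> U / W \subset K.
Proof.
move=> PK; have nW := normal_norm (pcen_normal chU).
have sXN : [set x ^+ (p ^ 1) | x in P] \subset 'N(W).
  by apply/subsetP=> _ /imsetP[x Px ->]; rewrite groupX // (subsetP nW).
rewrite (MhoE 1 pP) quotient_gen // gen_subG.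
by apply/subsetP=> _ /morphimP[_ _ /imsetP[x Px ->] ->]; apply: PK.
Qed.

Section Class3.

Hypothesis class3 : [~: P, P, P] \subset U.

(** Modulo [W] the subgroup [U] becomes central of exponent p, which is the setting of
    [expMg_pclass3]. *)
Lemma coset_powM : {in P &, {morph (fun x => coset W (x ^+ p)) : x y / x * y}}.
Proof.
have nW := subsetP (normal_norm (pcen_normal chU)).
move=> x y Px Py; rewrite !morphX ?groupM ?nW // morphM ?nW //=.
apply: (expMg_pclass3 (G := P / W) (V := U / W)) => //; rewrite ?mem_quotient //.
- exact: pcen_cent.
- exact: pcen_exp.
- move=> _ /morphimP[z Nz Pz ->]; rewrite -morphX //.
  by rewrite mem_quotient ?pow_Mho1.
move=> _ _ _ /morphimP[s Ns Ps ->] /morphimP[t Nt Pt ->] /morphimP[r Nr Pr ->].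
rewrite -!morphR ?groupR // mem_quotient // (subsetP class3) //.
by rewrite !mem_commg.
Qed.

Definition coset_pow_morphism := Morphism coset_powM.

End Class3.

End PowerSeries.

(** * Descent on eigenvectors *)

Section Eigenvectors.

Variables (p q : nat) (gT : finGroupType) (P : {group gT}) (a : {perm gT}).
Hypotheses (pr_p : prime p) (pr_q : prime q) (maxP : maximal_pair p q 2 P a).
Hypothesis p_gt3 : 3 < p.

Let pP : p.-group P := maximal_pair_pgroup maxP.
Local Notation U := 'Mho^1(P).
Local Notation W := (pcen P 'Mho^1(P)).

Variable n : nat.
Hypothesis n_neq1 : n != 1 %[mod p].

(** As [x ^+ p] is a Frattini element, it cannot generate P together with [y]; these two
    eigenvectors thus lie in a cyclic p-group, where orders decide inclusion. Since [y] is not a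
    power of [x ^+ p], the latter is a power of [y] of smaller order. *)
Lemma eigen_pow_cycle x y : x \in P -> y \in P -> a x = x ^+ n -> a y = y ^+ n ->
  <<[set x; y]>> = P -> x ^+ p \in <[y ^+ p]>.
Proof.
move=> Px Py ax ay genP.
have nc z : <[z]> != P.
  apply: contra (pair_not_cyclic maxP) => /eqP <-; exact: cycle_cyclic.
have not_y (z : gT) : z \in <[x]> -> y \notin <[z]>.
  move=> xz; apply: contra (nc x) => yz; rewrite eqEsubset cycle_subG Px.
  rewrite -{1}genP gen_subG subUset !sub1set cycle_id /=.
  by rewrite -cycle_subG (subset_trans _ (_ : <[z]> \subset _)) ?cycle_subG.
have axp : a (x ^+ p) = (x ^+ p) ^+ n.
  by rewrite (pair_autX maxP) // ax -!expgM mulnC.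
have [genP' | cyc] := eigen_gen2 maxP (groupX p Px) Py axp ay n_neq1.
  case/eqP: (nc y); apply: Phi_nongen; apply/eqP.
  rewrite eqEsubset join_subG Phi_sub sub1set Py -{1}genP' gen_subG.
  rewrite subUset !sub1set !mem_gen ?inE ?eqxx ?orbT //.
  by rewrite (subsetP (Mho1_sub_Phi pP)) ?(pow_Mho1 pP).
pose K := <<[set x ^+ p; y]>>%G; rewrite -[<<_>>]/(gval K) in cyc.
have pK : p.-group K by rewrite (pgroupS _ pP) // gen_subG subUset !sub1set groupX // Py.
have Kx : <[x ^+ p]> \subset K by rewrite cycle_subG mem_gen ?set21.
have Ky : <[y]> \subset K by rewrite cycle_subG mem_gen ?set22.
have sub_of_dvd (s t : gT) : s \in K -> t \in K -> #[s] <= #[t] -> s \in <[t]>.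
  move=> Ks Kt le_st; rewrite -cycle_subG.
  rewrite -(cardSg_cyclic cyc) ?cycle_subG // -!orderE.
  move: le_st; have [i ->] := p_natP (mem_p_elt pK Ks); have [j ->] := p_natP (mem_p_elt pK Kt).
  by rewrite leq_exp2l ?prime_gt1 // => /dvdn_exp2l.
have [leyx | ltxy] := leqP #[y] #[x ^+ p].
  have /not_y/negP[] : x ^+ p \in <[x]> by rewrite mem_cycle.
  by rewrite sub_of_dvd // -cycle_subG.
have /cycleP[i xE] : x ^+ p \in <[y]>.
  by rewrite sub_of_dvd ?(ltnW ltxy) // -cycle_subG.
(* An exponent [i] prime to p would give [x ^+ p] the same order as [y]. *)
have [/dvdnP[k iE] | p'i] := boolP (p %| i).
  by rewrite xE iE mulnC expgM mem_cycle.
have /eqP cop : coprime #[y] i by rewrite (pnat_coprime (mem_p_elt pP Py)) // p'natE.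
by move: ltxy; rewrite xE orderXgcd cop divn1 ltnn.
Qed.

(** The closure hypothesis on [v * u * v] is met in two situations: when [a] is a power map on all
    of P, and when eigenvectors are the inverted elements. *)
Lemma eigen_gen_Mho1_trivial x y : x \in P -> y \in P -> a x = x ^+ n -> a y = y ^+ n ->
    <<[set x; y]>> = P -> [~: P, P, P] \subset U ->
    {in P &, forall u v, a u = u ^+ n -> a v = v ^+ n -> a (v * u * v) = (v * u * v) ^+ n} ->
  U = 1.
Proof.
move=> Px Py ax ay genP class3 eigM; apply: (sub_pcen_trivial pP (Mho_char 1 P)).
have nWP : P \subset 'N(W) := normal_norm (pcen_normal (Mho_char 1 P)).
have nW := subsetP nWP.
pose phi := coset_pow_morphism pr_p p_gt3 pP class3.
set Y := phi y.
have cycX (u v : gT) : u \in P -> v \in P -> u ^+ p \in <[v ^+ p]> -> phi u \in <[phi v]>.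
  move=> Pu Pv /cycleP[i E]; apply/cycleP; exists i.
  by rewrite /= E [LHS]morphX // nW // groupX.
have Yx : phi x \in <[Y]> by rewrite cycX // eigen_pow_cycle.
have phiP z : z \in P -> phi z \in <[Y]>.
  move=> Pz; have : phi z \in phi @* P by rewrite mem_morphim.
  have -> : phi @* P = <<phi @* [set x; y]>>.
    by rewrite -morphim_gen ?genP // subUset !sub1set Px.
  apply: subsetP.
  rewrite gen_subG; apply/subsetP=> _ /morphimP[t Pt /set2P[]-> ->] //.
  exact: cycle_id.
have sUY : U / W \subset <[Y]> by apply: (Mho1_quotient_sub pP phiP).
have Yp : Y ^+ p = 1.
  apply: (pcen_exp pP (Mho_char 1 P)); rewrite mem_quotient //; exact: pow_Mho1.
have /cycleP[i xE] := Yx.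
have pE : p = (2 * p.-1./2).+1.
  by have [p2|] := even_prime pr_p; [move: p_gt3; rewrite p2 | lia].
(* Since [phi x = Y ^+ i], the image of [w] is [Y] to the power i + 2j, and this [j] makes i + 2j =
   p i. *)
pose j := (i * p.-1./2)%N; pose w := y ^+ j * x * y ^+ j.
have Pyj : y ^+ j \in P by rewrite groupX.
have Pw : w \in P by rewrite !groupM.
have aw : a w = w ^+ n.
  by apply: eigM => //; rewrite (pair_autX maxP) // ay -!expgM mulnC.
have phiw : phi w = 1.
  rewrite /w !morphM ?groupM // morphX // xE -!expgD.
  have -> : (j + i + j = p * i)%N by rewrite pE /j; lia.
  by rewrite expgM Yp expg1n.
have genPw : <<[set w; y]>> = P.
  apply/eqP; rewrite eqEsubset gen_subG subUset !sub1set Pw Py /=.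
  have yG : y \in <<[set w; y]>> by rewrite mem_gen ?set22.
  rewrite -{1}genP gen_subG subUset !sub1set yG andbT.
  rewrite -(groupMl _ (groupX j yG)) -(groupMr _ (groupX j yG)).
  by rewrite mem_gen ?set21.
(* The eigenvectors [w] and [y] again generate P, so [y ^+ p] is a power of [w ^+ p], which is
   trivial modulo [W]. *)
have /set1gP Y1 : Y \in [1 coset_of W].
  rewrite -cycle1 -phiw cycX //; apply: eigen_pow_cycle => //.
  by rewrite setUC.
rewrite -(quotient_sub1 (H := pcen_group P 'Mho^1(P)) (subset_trans (Mho_sub _ _) nWP)).
by rewrite (subset_trans sUY) // Y1 cycle1.
Qed.

End Eigenvectors.

(** * Commutators and p-th powers in class 2 *)

Lemma coset_eq_mul (gT : finGroupType) (H : {group gT}) (x y : gT) :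
    x \in 'N(H) -> y \in 'N(H) -> coset H x = coset H y ->
  exists2 u, u \in H & x = y * u.
Proof.
move=> Nx Ny eqxy; exists (y^-1 * x); last by rewrite mulKVg.
apply: coset_idr; first by rewrite groupM ?groupV.
by rewrite [LHS]morphM ?groupV //= morphV //= eqxy mulVg.
Qed.

Lemma commg_mulZ (gT : finGroupType) (G : {group gT}) (x y u v : gT) :
    x \in G -> y \in G -> u \in 'Z(G) -> v \in 'Z(G) ->
  [~ x * u, y * v] = [~ x, y].
Proof.
move=> Gx Gy /centerP[Gu cu] /centerP[Gv cv].
have c1 (s z : gT) : s \in G -> {in G, forall t, commute z t} -> [~ s, z] = 1.
  by move=> Gs cz; apply/eqP/commgP/commute_sym/cz.
have J1 (z t : gT) : z \in G -> {in G, forall s, commute t s} -> z ^ t = z.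
  by move=> Gz ct; rewrite conjgE -ct // mulKg.
rewrite commMgJ J1 ?groupR ?groupM // commgMJ c1 // mul1g J1 ?groupR //.
suff -> : [~ u, y * v] = 1 by rewrite mulg1.
by apply/eqP; rewrite -invg_eq1 invg_comm c1 ?groupM.
Qed.

Lemma cycle_expg_coprime (gT : finGroupType) (x : gT) k :
  coprime #[x] k -> exists m, x = x ^+ k ^+ m.
Proof.
by move=> cop; exists (expg_invn <[x]> k); rewrite (expgK (G := <[x]>)) ?cycle_id.
Qed.

Section Class2.

Variables (p : nat) (gT : finGroupType) (G : {group gT}).
Hypotheses (pr_p : prime p) (p_gt2 : 2 < p) (pG : p.-group G).
Hypotheses (derZ : G^`(1) \subset 'Z(G)).
Hypothesis der_exp : {in G^`(1), forall v, v ^+ p = 1}.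

Let comR x y z : x \in G -> y \in G -> z \in G -> commute [~ x, y] z.
Proof.
move=> Gx Gy; have /centerP[_ cR] := subsetP derZ _ (mem_commg Gx Gy); exact: cR.
Qed.

Let com_pow k : p %| k -> {in G &, forall x y, [~ x, y] ^+ k = 1}.
Proof.
move=> /dvdnP[m ->] x y Gx Gy; rewrite mulnC expgM der_exp ?mem_commg //.
exact: expg1n.
Qed.

Lemma expMg_class2 k : {in G &, {morph (fun x => x ^+ (p ^ k)) : x y / x * y}}.
Proof.
elim: k => [|k IHk] x y Gx Gy //=; rewrite expnSr !expgM IHk //.
set s := x ^+ _; set t := y ^+ _; have [Gs Gt] : s \in G /\ t \in G by rewrite !groupX.
rewrite expMg_Rmul; try by apply/commute_sym; apply: comR.
by rewrite com_pow ?mulg1 // prime_dvd_bin // p_gt2.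
Qed.

Lemma expg_class2_central : {in G, forall x, x ^+ p \in 'Z(G)}.
Proof.
move=> x Gx; apply/centerP; split=> [|y Gy]; first exact: groupX.
apply/commgP/eqP; rewrite commXg ?com_pow //.
by apply/commute_sym/comR.
Qed.

(** The p-th power map is an endomorphism, so its image is already a subgroup. *)
Lemma Mho1_class2 v : v \in 'Mho^1(G) -> exists2 x, x \in G & v = x ^+ p.
Proof.
pose f := Morphism (expMg_class2 1); suffices /subsetP sMf : 'Mho^1(G) \subset f @* G.
  by move=> /sMf/morphimP[x _ Gx ->]; exists x => //=; rewrite expn1.
rewrite (MhoE 1 pG) gen_subG; apply/subsetP=> _ /imsetP[x Gx ->].
exact: (mem_morphim f).
Qed.

End Class2.

(** * The case where the derived subgroup lies in [U]: P is abelian *)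

Section PowerfulCase.

Variables (p q : nat) (gT : finGroupType) (P : {group gT}) (a : {perm gT}).
Hypotheses (pr_p : prime p) (pr_q : prime q) (maxP : maximal_pair p q 2 P a).
Hypothesis p_gt3 : 3 < p.

Let pP : p.-group P := maximal_pair_pgroup maxP.
Local Notation U := 'Mho^1(P).

Lemma pair_scalar_mul : exists l : nat,
  [/\ l != 1 %[mod p], l ^ q = 1 %[mod p], coprime p l &
      {in P, forall x, exists2 u, u \in 'Phi(P) & a x = x ^+ l * u}].
Proof.
have [l [l1 al lq cop]] := pair_scalar pr_p pr_q maxP.
exists l; split=> // x Px; have nP := subsetP (normal_norm (Phi_normal P)).
apply: coset_eq_mul; rewrite ?nP ?groupX ?(pair_aut_closed maxP) //.
by rewrite al // morphX // nP.
Qed.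

(* The commutator quotient has eigenvalue l ^ 2, while every layer of p-th powers has
   eigenvalue l: a commutator that is a p ^ k-th power modulo R is a p ^ k.+1-th one. *)
Lemma powerful_pair_abelian : P^`(1) \subset U -> abelian P.
Proof.
move=> sDU; have chD : P^`(1) \char P := der_char 1 P.
apply/derG1P/(sub_pcen_trivial pP chD); rewrite gen_subG.
apply/subsetP=> _ /imset2P[x y Px Py ->]; apply: contraT => nRc.
pose R := pcen_group P P^`(1); have {nRc} nRc : [~ x, y] \notin R := nRc.
have nsRP : R <| P := pcen_normal chD.
have nR := subsetP (normal_norm nsRP).
have aP := pair_aut_closed maxP.
pose G := (P / R)%G.
have Gbar z : z \in P -> coset R z \in G by apply: mem_quotient.
have pG : p.-group G by apply: quotient_pgroup.
have derG : G^`(1) = P^`(1) / R by rewrite quotient_der ?(normal_norm nsRP).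
have derZ : G^`(1) \subset 'Z(G) by rewrite derG pcen_cent.
have der_exp : {in G^`(1), forall v, v ^+ p = 1} by rewrite derG; apply: pcen_exp.
have p_gt2 : 2 < p := ltnW p_gt3.
(* Here ['Phi(P)] equals [U], and modulo [R] the class 2 results apply, so its elements become p-th
   powers. *)
have barU u : u \in 'Phi(P) -> exists2 v, v \in G & coset R u = v ^+ p.
  move=> Pu; apply: (Mho1_class2 pr_p p_gt2 pG derZ der_exp).
  rewrite -morphim_Mho ?(normal_norm nsRP) // mem_quotient //.
  by move: Pu; rewrite (Phi_joing pP) (joing_idPr sDU).
have [l [l1 _ cop_l al]] := pair_scalar_mul.
set c := [~ x, y] in nRc; pose A := coset R x; pose B := coset R y.
have cE : coset R c = [~ A, B] by rewrite [LHS]morphR ?nR.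
have Pc : c \in P by rewrite groupR.
have cp : coset R c ^+ p = 1 by rewrite der_exp // derG mem_quotient ?mem_commg.
have barc1 : coset R c != 1 by apply: contra nRc => /eqP; apply: coset_idr; apply: nR.
have oc : #[coset R c] = p by apply: nt_prime_order.
have ac : coset R (a c) = coset R c ^+ (l * l).
  have [u Pu ax] := al x Px; have [v Pv ay] := al y Py.
  have [uP vP] := (subsetP (Phi_sub P) u Pu, subsetP (Phi_sub P) v Pv).
  rewrite (pair_autR maxP) // [LHS]morphR ?nR ?aP //= ax ay.
  rewrite cE !morphM ?morphX ?nR ?groupX //= (commg_mulZ (G := G)) ?groupX ?Gbar //.
  - have /centerP[_ cR] := subsetP derZ _ (mem_commg (Gbar x Px) (Gbar y Py)).
    by rewrite commXXg //; apply/commute_sym/cR/Gbar.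
  - by have [w Gw ->] := barU u Pu; apply: expg_class2_central.
  by have [w Gw ->] := barU v Pv; apply: expg_class2_central.
(* Take [k] maximal such that the image of [c] is a p^k-th power; it exists because this image is
   not 1. *)
pose pw k := [exists g in G, g ^+ (p ^ k) == coset R c].
have pw0 : exists k, pw k by exists 0; apply/existsP; exists (coset R c); rewrite Gbar ?expg1 /=.
have pw_bound k : pw k -> k <= logn p #|G|.
  case/existsP=> g /andP[Gg /eqP gc]; rewrite leqNgt; apply/negP=> ltk.
  case/eqP: barc1; rewrite -gc; apply/eqP; rewrite -order_dvdn.
  rewrite (dvdn_trans (order_dvdG Gg)) // (card_pgroup pG) dvdn_exp2l //; exact: ltnW.
case: (ex_maxnP pw0 pw_bound) => k /existsP[g /andP[Gg /eqP gc]] max_k.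
suff /max_k : pw k.+1 by rewrite ltnn.
case/morphimP: Gg => g0 Ng0 Pg0 gE.
have [r Rr cr] : exists2 r, r \in R & c = g0 ^+ (p ^ k) * r.
  by apply: coset_eq_mul; rewrite ?nR ?groupX // -gc gE morphX.
have sRP := subsetP (normal_sub nsRP).
have [u Pu ag] := al g0 Pg0; have [v Gv uv] := barU u Pu.
have uP := subsetP (Phi_sub P) u Pu.
(* A second computation of [a c], now from [c = g0 ^+ (p ^ k) * r]: the Frattini error of [a g0] is
   a p-th power, hence contributes a p^(k+1)-th power. *)
have ac' : coset R (a c) = coset R c ^+ l * v ^+ (p ^ k.+1).
  have Pr := sRP r Rr.
  have -> : a c = a g0 ^+ (p ^ k) * a r.
    by rewrite {1}cr (pair_autM maxP) ?groupX // (pair_autX maxP).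
  have Rar : a r \in R by apply: (pair_aut_char maxP (pcen_char chD)).
  rewrite [LHS]morphM ?nR ?groupX ?aP //= [coset _ (a r)]coset_id // mulg1.
  rewrite [LHS]morphX ?nR ?aP //= ag [coset _ (_ * u)]morphM ?nR ?groupX //= uv.
  have Gg : coset R g0 \in G by apply: Gbar.
  rewrite [coset _ (g0 ^+ l)]morphX ?nR //= (expMg_class2 pr_p p_gt2 derZ der_exp) ?groupX //.
  by rewrite -gc gE -!expgM -expnS [in LHS]mulnC.
have l_gt0 : 0 < l.
  by rewrite lt0n; apply: contraL cop_l => /eqP->; rewrite /coprime gcdn0 gtn_eqF ?prime_gt1.
(* Equating both values of [a c]; as l (l - 1) is prime to p, the image of [c] itself is a
   p^(k+1)-th power, against the choice of [k]. *)
have cl : coset R c ^+ (l * l.-1) = v ^+ (p ^ k.+1).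
  apply: (mulgI (coset R c ^+ l)); rewrite -ac' ac -expgD; congr (_ ^+ _).
  by rewrite -mulnS prednK.
have [|m cm] := @cycle_expg_coprime _ (coset R c) (l * l.-1).
  rewrite oc coprimeMr cop_l prime_coprime //=; apply: contra l1 => /dvdnP[s ls].
  by rewrite -(prednK l_gt0) ls -addn1 modnMDl.
apply/existsP; exists (v ^+ m); rewrite groupX //=.
by rewrite [X in _ == X]cm cl -!expgM mulnC.
Qed.

End PowerfulCase.

(** * The abelian case *)

(** As in the expansion of (m + p^(k+1) t)^p, the first-order error occurs p times and higher ones
    carry p^(2k+2), so precision improves by one factor p. *)
Lemma abelian_aut_expn_step p m k (gT : finGroupType) (P : {group gT}) (b : {perm gT}) :
    abelian P -> b \in Aut P ->
    {in P, forall x, exists2 w, w \in P & b x = x ^+ m * w ^+ (p ^ k.+1)} ->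
  {in P, forall x, exists2 w, w \in P & (b ^+ p) x = x ^+ (m ^ p) * w ^+ (p ^ k.+2)}.
Proof.
move=> cPP Autb bX x Px; have [w Pw bx] := bX x Px.
have expM (s t : gT) i : s \in P -> t \in P -> (s * t) ^+ i = s ^+ i * t ^+ i.
  by move=> Ps Pt; rewrite expgMn //; apply: (centsP cPP).
have bM (s t : gT) : s \in P -> t \in P -> b (s * t) = b s * b t.
  by move=> Ps Pt; rewrite -(autmE Autb) morphM.
have bXn (s : gT) i : s \in P -> b (s ^+ i) = b s ^+ i.
  by move=> Ps; rewrite -(autmE Autb) morphX.
(* First-order expansion of [b ^+ j]; at j = 0 the truncated [j.-1] is harmless, being multiplied by
   [j]. *)
have bj j : exists2 z, z \in P & (b ^+ j) x =
    x ^+ (m ^ j) * w ^+ (p ^ k.+1 * (j * m ^ j.-1)) * z ^+ (p ^ k.+2).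
  elim: j => [|j [z Pz IHj]].
    by exists 1; rewrite ?group1 // perm1 mul0n muln0 expg1n !mulg1.
  have [w' Pw' bw] := bX w Pw.
  have Pbz : b z \in P by rewrite -(autmE Autb) -{2}(im_autm Autb) mem_morphim.
  exists (w' ^+ (p ^ k * (j * m ^ j.-1)) * b z); first by rewrite groupM ?groupX.
  rewrite expgSr permM IHj !bM ?groupM ?groupX // !bXn // bx bw !expM ?groupX //.
  rewrite -!expgM -!mulgA -expnS; congr (_ * _).
  rewrite !mulgA -expgD; congr (_ ^+ _ * _ ^+ _ * _).
    case: j {IHj} => [|j] /=; first by rewrite !mul0n !muln0 addn0 mul1n.
    by rewrite [(m ^ j.+1)%N]expnS; move: (p ^ k.+1)%N (m ^ j)%N => A B; lia.
  by rewrite !expnS; move: (p ^ k)%N (m ^ j.-1)%N => A B; lia.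
have [z Pz ->] := bj p; exists (w ^+ (m ^ p.-1) * z); first by rewrite groupM ?groupX.
rewrite expM ?groupX // -!mulgA -!expgM; congr (_ * (_ ^+ _ * _)).
by rewrite !expnS; move: (p ^ k)%N (m ^ p.-1)%N => A B; lia.
Qed.

Section AbelianCase.

Variables (p q : nat) (gT : finGroupType) (P : {group gT}) (a : {perm gT}).
Hypotheses (pr_p : prime p) (pr_q : prime q) (maxP : maximal_pair p q 2 P a).
Hypothesis p_gt3 : 3 < p.

Let pP : p.-group P := maximal_pair_pgroup maxP.
Let AutPa : a \in Aut P := maximal_pair_aut maxP.

(** Repeated p-th powers of [a] remove the error: with |P| = p^N, [a ^+ (p ^ N)] is exactly a power
    map, and [a] is a power of it because q divides p - 1 and so differs from p. *)
Lemma abelian_pair_power : abelian P ->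
  exists n, n != 1 %[mod p] /\ {in P, forall x, a x = x ^+ n}.
Proof.
move=> cPP; have [l [l1 _ _ al]] := pair_scalar_mul pr_p pr_q maxP.
have apk k : {in P, forall x, exists2 w, w \in P &
    (a ^+ (p ^ k)) x = x ^+ (l ^ (p ^ k)) * w ^+ (p ^ k.+1)}.
  elim: k => [|k IHk] x Px.
    have [u Pu ->] := al x Px; move: Pu.
    rewrite (Phi_Mho pP cPP) (MhoEabelian 1 pP cPP) => /imsetP[w Pw ->].
    by exists w.
  rewrite !(expnSr p) expgM [(l ^ _)%N]expnM -!(expnSr p).
  by apply: abelian_aut_expn_step IHk x Px => //; apply: groupX.
pose N := logn p #|P|.
have aN x : x \in P -> (a ^+ (p ^ N)) x = x ^+ (l ^ (p ^ N)).
  move=> Px; have [w Pw ->] := apk N x Px.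
  by rewrite expnSr expgM -(card_pgroup pP) expg_cardG // expg1n mulg1.
have Xiter j x : x \in P -> ((a ^+ (p ^ N)) ^+ j) x = x ^+ ((l ^ (p ^ N)) ^ j).
  move=> Px; elim: j => [|j IHj]; first by rewrite perm1 expn0 expg1.
  have bX (y : gT) e : y \in P -> (a ^+ (p ^ N)) (y ^+ e) = (a ^+ (p ^ N)) y ^+ e.
    by move=> Py; rewrite -(autmE (groupX (p ^ N) AutPa)) morphX.
  by rewrite expgSr permM IHj bX // aN // -expgM -expnS.
have cop : coprime #[a] (p ^ N).
  rewrite (maximal_pair_order maxP) coprimeXr // prime_coprime // dvdn_prime2 //.
  have p1_gt0 : 0 < p.-1 by rewrite -subn1 subn_gt0 prime_gt1.
  apply/eqP=> pq; have := dvdn_leq p1_gt0 (maximal_pair_dvd maxP).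
  by rewrite pq leqNgt ltn_predL prime_gt0.
have [j aE] := cycle_expg_coprime cop.
exists ((l ^ (p ^ N)) ^ j)%N; have aX x : x \in P -> a x = x ^+ ((l ^ (p ^ N)) ^ j).
  by move=> Px; rewrite {1}aE Xiter.
(* On the Frattini quotient the new exponent must agree with [l] mod p. *)
split=> //; apply: contra l1 => n1.
have /trivgPn[z Ez ntz] : P / 'Phi(P) != 1.
  apply: contra (pair_not_cyclic maxP) => /eqP P1; apply: Phi_quotient_cyclic.
  by rewrite P1 cyclic1.
have oz := abelem_order_p (Phi_quotient_abelem pP) Ez ntz.
case/morphimP: Ez => x Nx Px zE; have [u Pu ax] := al x Px.
have Nu : u \in 'N('Phi(P)) by rewrite (subsetP (normG _)).
have := congr1 (coset 'Phi(P)) ax; rewrite aX //.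
rewrite [coset _ (x ^+ l * u)]morphM ?groupX //= (coset_id Pu) mulg1 !morphX //= => /eqP.
rewrite -[coset _ x]/(coset_morphism _ x) -zE eq_expg_mod_order oz.
by move/eqP <-.
Qed.

Lemma pair_gen2 : exists x y, [/\ x \in P, y \in P & <<[set x; y]>> = P].
Proof.
have [B genB] := grank_witness P; rewrite (maximal_pair_rank maxP) => /eqP/cards2P[x [y [_ BE]]].
by exists x, y; rewrite -BE genB -genB !mem_gen // BE ?set21 ?set22.
Qed.

Lemma abelian_pair : abelian P -> p.-abelem P /\ #|P| = (p ^ 2)%N.
Proof.
move=> cPP; have [n [n1 aX]] := abelian_pair_power cPP.
have [x [y [Px Py genP]]] := pair_gen2.
have U1 : 'Mho^1(P) = 1.
  apply: (eigen_gen_Mho1_trivial pr_p pr_q maxP p_gt3 n1 Px Py) => //; rewrite ?aX //.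
    by rewrite (commG1P cPP) comm1G sub1G.
  by move=> u v Pu Pv _ _; rewrite aX ?groupM.
have abP : p.-abelem P.
  by rewrite -(trivg_Phi pP) (Phi_Mho pP cPP) U1.
split=> //; rewrite (card_pgroup pP) -(rank_abelem abP) -grank_abelian //.
by rewrite (maximal_pair_rank maxP).
Qed.

End AbelianCase.

(** * Groups of exponent dividing p whose subgroups are 2-generated *)

Section ExponentP.

Variables (p : nat) (gT : finGroupType) (G : {group gT}).
Hypotheses (pr_p : prime p) (pG : p.-group G).

(** If [A] is not central, it is generated by its non-trivial central part and any non-central [x],
    so centralising [A] amounts to centralising [x]. *)
Lemma index_cent_normal_card_p2 (A : {group gT}) :
  A <| G -> abelian A -> #|A| <= p ^ 2 -> #|G : 'C_G(A)| <= p.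
Proof.
move=> nsAG cAA leA; have sAG := normal_sub nsAG.
have p_gt1 := prime_gt1 pr_p.
have [sAZ | /subsetPn[x Ax nZx]] := boolP (A \subset 'Z(G)).
  have -> : 'C_G(A) = G.
    by apply/setIidPl; rewrite centsC (subset_trans sAZ) ?subsetIr.
  by rewrite indexgg ltnW.
have Gx := subsetP sAG x Ax.
pose Z := (A :&: 'Z(G))%G; have sZA : Z \subset A by apply: subsetIl.
have pA := pgroupS sAG pG; have pZ := pgroupS sZA pA.
have ntZ : Z :!=: 1.
  apply: meet_center_nil (pgroup_nil pG) nsAG _.
  by apply: contraNneq nZx => A1; move: Ax; rewrite A1 => /set1P->; apply: group1.
pose B := (<[x]> <*> Z)%G.
have sBA : B \subset A by rewrite join_subG cycle_subG Ax.
have ltZB : Z \proper B.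
  apply/properP; split; first exact: joing_subr.
  exists x; first by rewrite mem_gen // inE cycle_id.
  by rewrite inE Ax.
have defA : B :=: A.
  apply/eqP; rewrite eqEcard sBA (leq_trans leA) //.
  move: (proper_card ltZB) (pgroupS sBA pA) ntZ.
  rewrite -cardG_gt1; move: pZ => /card_pgroup-> ltZB' /card_pgroup oB.
  move: ltZB'; rewrite oB ltn_exp2l // => ltij.
  have [-> // | i_gt0 _] := posnP (logn p #|Z|); rewrite leq_exp2l //.
  exact: leq_trans ltij.
have sCC : 'C_G[x] \subset 'C_G(A).
  rewrite -defA subsetI subsetIl /= centY cent_cycle subsetI subsetIr /=.
  rewrite (subset_trans (subsetIl _ _)) // centsC (subset_trans (subsetIr _ _)) //.
  exact: subsetIr.
apply: leq_trans (_ : #|G : 'C_G[x]| <= p).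
  by rewrite dvdn_leq ?indexgS // indexSg ?subsetIl.
have p_ind : p.-nat #|G : 'C_G[x]| := pnat_dvd (dvdn_indexg _ _) pG.
(* The class of [x] lies in [A] and misses 1. *)
have : #|G : 'C_G[x]| < p ^ 2.
  rewrite index_cent1; apply: leq_trans leA.
  apply/proper_card/properP; split; first by rewrite class_sub_norm ?(normal_norm nsAG).
  exists 1; rewrite ?group1 //; apply/imsetP=> -[y Gy /eqP].
  by rewrite eq_sym conjg_eq1 => /eqP x1; rewrite x1 group1 in nZx.
have [m ->] := p_natP p_ind; rewrite ltn_exp2l // => m_le1.
by rewrite -[X in _ <= X]expn1 leq_exp2l.
Qed.

(** A maximal normal abelian subgroup is its own centraliser and elementary abelian of rank at most
    2, so it has order at most p^2 and index at most p. *)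
Lemma card_exponent_p_grank2 :
    {in G, forall x, x ^+ p = 1} -> (forall H : {group gT}, H \subset G -> 'm(H) <= 2) ->
  #|G| <= p ^ 3.
Proof.
move=> expG rkG; have p_gt1 := prime_gt1 pr_p.
have [A maxA _] : {A : {group gT} | [max A | A <| G & abelian A] & (1%G : {group gT}) \subset A}.
  by apply: maxgroup_exists; rewrite normal1 abelian1.
have SCN_A := max_SCN pG maxA; have [nsAG defC] := SCN_P SCN_A.
have cAA := SCN_abelian SCN_A; have sAG := normal_sub nsAG.
have abA : p.-abelem A.
  by apply/abelemP=> //; split=> // x /(subsetP sAG)/expG.
have leA : #|A| <= p ^ 2.
  rewrite (card_pgroup (pgroupS sAG pG)) leq_exp2l // -(rank_abelem abA).
  by rewrite -grank_abelian // rkG.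
rewrite -(Lagrange sAG) (expnSr p 2) leq_mul //.
by rewrite -{1}defC index_cent_normal_card_p2.
Qed.

End ExponentP.

(** * The case where the derived subgroup is not contained in [U] *)

Section Nonpowerful.

Variables (p q : nat) (gT : finGroupType) (P : {group gT}) (a : {perm gT}).
Hypotheses (pr_p : prime p) (pr_q : prime q) (maxP : maximal_pair p q 2 P a).
Hypothesis p_gt3 : 3 < p.

Let pP : p.-group P := maximal_pair_pgroup maxP.
Local Notation U := 'Mho^1(P).
Local Notation W := (pcen_group P 'Mho^1(P)).

Hypothesis not_sDU : ~~ (P^`(1) \subset U).

Let nsUP : U <| P := Mho_normal 1 P.
Let nU := subsetP (normal_norm nsUP).
Let nsWP : W <| P := pcen_normal (Mho_char 1 P).
Let nW := subsetP (normal_norm nsWP).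

(** P / [U] inherits the bound on generators and has exponent dividing p, so its order is at most
    p^3; it is also non-abelian. *)
Lemma quotient_Mho1_extraspecial : extraspecial (P / U) /\ #|P / U| = (p ^ 3)%N.
Proof.
have pQ : p.-group (P / U) := quotient_pgroup _ pP.
have leQ : #|P / U| <= p ^ 3.
  apply: card_exponent_p_grank2 pQ _ _ => //.
    move=> _ /morphimP[x Nx Px ->]; rewrite -morphX //= coset_id //.
    exact: (pow_Mho1 pP).
  move=> H sHQ; have [K defH _ sKP] := inv_quotientS nsUP sHQ.
  rewrite defH (leq_trans (quotient_grank _)) ?(maximal_pair_sub maxP) //.
  exact: subset_trans sKP (normal_norm nsUP).
have logQ : logn p #|P / U| <= 3.
  by rewrite -(leq_exp2l _ _ (prime_gt1 pr_p)) -card_pgroup.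
have ncQ : ~~ abelian (P / U).
  by apply: contra not_sDU => cQ; rewrite der1_min ?(normal_norm nsUP).
have esQ := p3group_extraspecial pQ ncQ logQ.
split=> //; apply/eqP; rewrite eqn_leq leQ min_card_extraspecial //.
Qed.

Lemma lcn3_sub_Mho1 : [~: P, P, P] \subset U.
Proof.
have [[[_ defD] _] _] := quotient_Mho1_extraspecial.
rewrite -quotient_cents2 ?comm_subG ?(normal_norm nsUP) //.
by rewrite quotientR ?(normal_norm nsUP) // -derg1 [_^`(1)]defD subsetIr.
Qed.

Let phi := coset_pow_morphism pr_p p_gt3 pP lcn3_sub_Mho1.

Lemma coset_pow_im : phi @* P = U / W.
Proof.
apply/eqP; rewrite eqEsubset; apply/andP; split.
  apply/subsetP=> _ /morphimP[x _ Px ->]; rewrite mem_quotient //.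
  exact: (pow_Mho1 pP).
by apply: (Mho1_quotient_sub pP) => x Px; apply: (mem_morphim phi).
Qed.

Lemma coset_pow_Phi : phi @* 'Phi(P) = 1.
Proof.
rewrite (morphim_Phi _ pP) // coset_pow_im; apply/eqP.
have pV : p.-group (U / W) by rewrite quotient_pgroup // (pgroupS (Mho_sub 1 P)).
rewrite (trivg_Phi pV); apply/abelemP=> //; split.
  have := pcen_cent (Mho_char 1 P); rewrite subsetI => /andP[sVG cVG].
  by rewrite /abelian (subset_trans cVG) ?centS.
exact: (pcen_exp pP (Mho_char 1 P)).
Qed.

Lemma proper_cycle_Phi x : x \in P -> <[x]> <*> 'Phi(P) \proper P.
Proof.
move=> Px; rewrite properEneq join_subG cycle_subG Px Phi_sub !andbT.
apply: contra (pair_not_cyclic maxP) => /eqP genP.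
rewrite -(@Phi_nongen _ P [set x]) ?cycle_cyclic //.
by rewrite -joing_idr joingC.
Qed.

(** Let M be this product. M / [U] is proper in a group of order p^3, hence abelian of exponent
    dividing p, so [U] contains the Frattini subgroup of M. Equality follows from indices: M is
    2-generated, while 1 < ['Phi(P)] / [U] < M / [U] forces |M : [U]| to be at least p^2. *)
Lemma Phi_cycle_Phi x : x \in P -> x \notin 'Phi(P) ->
  'Phi(<[x]> <*> 'Phi(P)) = U.
Proof.
move=> Px notPhix; pose M := (<[x]> <*> 'Phi(P))%G; rewrite -[_ <*> _]/(gval M).
have ltMP : M \proper P := proper_cycle_Phi Px; have sMP := proper_sub ltMP.
have pM := pgroupS sMP pP.
have [_ oQ] := quotient_Mho1_extraspecial.
have sUF := Mho1_sub_Phi pP.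
have sFM : 'Phi(P) \subset M := joing_subr _ _.
have sUM := subset_trans sUF sFM; have nUM := subset_trans sMP (normal_norm nsUP).
have pMU : p.-group (M / U) := quotient_pgroup _ pM.
have p_gt1 := prime_gt1 pr_p.
have ltMU : #|M / U| < p ^ 3.
  rewrite -oQ; apply: proper_card; rewrite properEneq quotientS // andbT.
  apply: contraTneq ltMP => eqMP; rewrite properE negb_and negbK orbC.
  by rewrite -(quotientSGK (normal_norm nsUP) sUM) eqMP subxx.
have logMU : logn p #|M / U| <= 2.
  by rewrite -ltnS -(ltn_exp2l _ _ p_gt1) -card_pgroup.
have sPhiU : 'Phi(M) \subset U.
  apply: (Phi_min pM nUM); apply/abelemP=> //; split.
    exact: p2group_abelian pMU logMU.
  move=> _ /morphimP[y Ny My ->]; rewrite -morphX //= coset_id //.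
  by rewrite (pow_Mho1 pP) ?(subsetP sMP).
apply/eqP; rewrite eqEcard sPhiU /=.
have : #|M : 'Phi(M)| <= #|M : U|.
  rewrite -!card_quotient ?gFnorm // (leq_trans (card_quotient_Phi_le pr_p maxP sMP)) //.
  have ltFM : 'Phi(P) / U \proper M / U.
    rewrite properEneq quotientS // andbT; apply: contraNneq notPhix => eqFM.
    suff : M \subset 'Phi(P) by move/subsetP; apply; rewrite mem_gen // inE cycle_id.
    by rewrite -(quotientSGK nUM sUF) eqFM.
  have ntF : 'Phi(P) / U != 1.
    apply: contra not_sDU; rewrite -subG1 quotient_sub1; last first.
      by rewrite (subset_trans (Phi_sub P)) ?(normal_norm nsUP).
    by move=> sFU; apply: subset_trans sFU; rewrite /= (Phi_joing pP) joing_subl.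
  have pFU : p.-group ('Phi(P) / U) by rewrite quotient_pgroup ?(pgroupS (Phi_sub P)).
  move: (proper_card ltFM) ntF; rewrite -cardG_gt1.
  rewrite (card_pgroup pMU) (card_pgroup pFU) ltn_exp2l // => ltij.
  have [-> // | i_gt0 _] := posnP (logn p #|'Phi(P) / U|); rewrite leq_exp2l //.
  exact: leq_trans ltij.
have sPhiM := Phi_sub M.
rewrite -(leq_pmul2l (cardG_gt0 'Phi(M))) Lagrange // -(Lagrange sUM).
by move=> le; rewrite leqNgt; apply/negP=> lt; move: le; rewrite leqNgt ltn_mul2r lt indexg_gt0.
Qed.

(** By [Phi_cycle_Phi], [U / W] is the Frattini subgroup of the abelian group M / [W], whose p-th
    powers lie in [<[phi x]>] because [phi] kills ['Phi(P)]. *)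
Lemma Mho1_quotient_cycle x : x \in P -> x \notin 'Phi(P) ->
    P^`(1) / W \subset 'C(P / W) ->
  U / W \subset <[phi x]>.
Proof.
move=> Px notPhix cDP; pose M := (<[x]> <*> 'Phi(P))%G.
have sMP : M \subset P := proper_sub (proper_cycle_Phi Px).
have nWP := normal_norm nsWP; have nWM := subset_trans sMP nWP.
have pM := pgroupS sMP pP.
rewrite -(Phi_cycle_Phi Px notPhix) (quotient_Phi pM nWM).
have Ux : phi x \in U / W by rewrite mem_quotient // (pow_Mho1 pP).
have cUP : U / W \subset 'C(P / W).
  by have := pcen_cent (Mho_char 1 P); rewrite subsetI => /andP[].
have cFP : 'Phi(P) / W \subset 'C(P / W).
  rewrite (Phi_joing pP) quotientY ?(subset_trans (der_sub 1 P)) ?(subset_trans (Mho_sub 1 P)) //.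
  by rewrite join_subG cDP.
have pMW : p.-group (M / W) := quotient_pgroup _ pM.
have cMK : M / W \subset 'C(<[phi x]>).
  by rewrite centsC cycle_subG (subsetP _ _ Ux) // (subset_trans cUP) ?centS ?quotientS.
apply: (Phi_min pMW); first exact: cents_norm.
have cMM : abelian (M / W).
  rewrite quotientY ?cycle_subG ?nW ?(subset_trans (Phi_sub P)) //.
  rewrite abelianY quotient_abelian ?cycle_abelian //=.
  rewrite /abelian !(subset_trans cFP) ?centS ?quotientS ?Phi_sub ?cycle_subG //.
apply/abelemP=> //; split; first exact: quotient_abelian.
move=> _ /morphimP[z Nz /morphimP[y Ny My zE] ->].
rewrite -morphX //; apply: coset_id; rewrite zE -morphX //.
have : phi y \in phi @* M by rewrite mem_morphim ?(subsetP sMP).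
apply: subsetP; rewrite morphimY ?cycle_subG ?Phi_sub // coset_pow_Phi joingG1.
by rewrite /= morphim_cycle.
Qed.

Lemma lcn3_not_sub : U :!=: 1 -> ~ {in P & &, forall x y z, [~ x, y, z] \in W}.
Proof.
move=> ntU cW; case/eqP: ntU; apply: (sub_pcen_trivial pP (Mho_char 1 P)).
have nWP := normal_norm nsWP.
have cDP : P^`(1) / W \subset 'C(P / W).
  rewrite quotient_der // gen_subG.
  apply/subsetP=> _ /imset2P[_ _ /morphimP[x Nx Px ->] /morphimP[y Ny Py ->] ->].
  apply/centP=> _ /morphimP[z Nz Pz ->]; apply/commgP.
  by rewrite -!morphR ?groupR //= coset_id ?cW.
have [x Px notFx] : exists2 x, x \in P & x \notin 'Phi(P).
  have /Phi_proper/properP[_ [x]] : P :!=: 1; last by exists x.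
  by apply: contra (pair_not_cyclic maxP) => /eqP->; apply: cyclic1.
have [_ [y Py notMy]] := properP (proper_cycle_Phi Px).
have Vy : phi y \in U / W by rewrite mem_quotient // (pow_Mho1 pP).
have /cycleP[i yE] := subsetP (Mho1_quotient_cycle Px notFx cDP) _ Vy.
(* Correcting [y] by a power of [x] kills its image under [phi] yet keeps it outside ['Phi(P)], so
   [U / W] lies in a trivial cycle. *)
pose z := y * x ^- i; have Pz : z \in P by rewrite groupM ?groupV ?groupX.
have phiz : phi z = 1.
  by rewrite morphM ?groupV ?groupX // morphV ?groupX // morphX // yE mulgV.
have notFz : z \notin 'Phi(P).
  apply: contra notMy => Fz; rewrite -(mulgKV (x ^+ i) y) groupM ?groupX //.
    by rewrite mem_gen // inE Fz orbT.
  by rewrite mem_gen // inE cycle_id.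
rewrite -quotient_sub1 ?(subset_trans (Mho_sub 1 P)) //.
by rewrite -cycle1 -phiz; apply: Mho1_quotient_cycle.
Qed.

Let Phi_quotient_center : 'Phi(P) / U = 'Z(P / U).
Proof.
have [[[defF _] _] _] := quotient_Mho1_extraspecial.
by rewrite -defF (quotient_Phi pP) ?(normal_norm nsUP).
Qed.

(** [U / W] is central, and ['Phi(P) / U] is the centre of an extraspecial group, hence cyclic. *)
Lemma Phi_quotient_abelian : abelian ('Phi(P) / W).
Proof.
have sUF := Mho1_sub_Phi pP; have sFP := Phi_sub P.
have [esQ _] := quotient_Mho1_extraspecial.
have cycFU : cyclic ('Phi(P) / U).
  rewrite Phi_quotient_center prime_cyclic //.
  by rewrite (card_center_extraspecial (quotient_pgroup _ pP) esQ).
have sUZ : U / W \subset 'Z('Phi(P) / W).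
  rewrite subsetI quotientS //=.
  have := pcen_cent (Mho_char 1 P); rewrite subsetI => /andP[_ cUP].
  by rewrite (subset_trans cUP) ?centS ?quotientS.
apply: cyclic_factor_abelian sUZ _.
have nsUF : U <| 'Phi(P) := normalS sUF sFP nsUP.
have nsWF : W <| 'Phi(P).
  by apply: normalS sFP nsWP; apply: subset_trans (pcen_sub (Mho_char 1 P)) sUF.
by rewrite (isog_cyclic (third_isog (pcen_sub (Mho_char 1 P)) nsWF nsUF)).
Qed.

(* Modulo W, a commutator [x, y, z] has eigenvalue l ^ 3, while U / W consists of p-th
   powers and so has eigenvalue l. *)
Lemma nonpowerful_eigenvalue l : U :!=: 1 -> l != 1 %[mod p] -> coprime p l ->
    {in P, forall x, exists2 u, u \in 'Phi(P) & a x = x ^+ l * u} ->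
  p %| l.+1.
Proof.
move=> ntU l1 cop_l al.
have [x Px [y Py [z Pz nWT]]] : exists2 x, x \in P & exists2 y, y \in P &
    exists2 z, z \in P & [~ x, y, z] \notin W.
  have : ~~ [forall x in P, forall y in P, forall z in P, [~ x, y, z] \in W].
    apply/negP=> /forall_inP cW; apply: (lcn3_not_sub ntU) => x y z Px Py Pz.
    by move/forall_inP: (cW x Px) => /(_ y Py)/forall_inP/(_ z Pz).
  rewrite negb_forall_in => /exists_inP[x Px]; rewrite negb_forall_in => /exists_inP[y Py].
  rewrite negb_forall_in => /exists_inP[z Pz nT].
  by exists x => //; exists y => //; exists z.
have aP := pair_aut_closed maxP.
have sFP := subsetP (Phi_sub P).
have sUP := subsetP (normal_sub nsUP); have sWP := subsetP (normal_sub nsWP).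
pose G := (P / W)%G; have Gq t : t \in P -> coset W t \in G by apply: mem_quotient.
have sVZ : U / W \subset 'Z(G) := pcen_cent (Mho_char 1 P).
set c := [~ x, y]; set T := [~ c, z].
have Pc : c \in P by rewrite groupR.
have PT : T \in P by rewrite groupR.
have UT : T \in U.
  by rewrite (subsetP lcn3_sub_Mho1) // !mem_commg.
have VT : coset W T \in U / W by apply: mem_quotient.
have ZT := subsetP sVZ _ VT.
have Fc : c \in 'Phi(P) by rewrite (Phi_joing pP) mem_gen // inE mem_commg.
(* Modulo [U] the Frattini errors of [a x] and [a y] are central, so they drop out of the
   commutator. *)
have ac : exists2 s, s \in U & a c = c ^+ (l * l) * s.
  apply: coset_eq_mul; rewrite ?nU ?groupX ?aP //.
  have [u Fu ax] := al x Px; have [v Fv ay] := al y Py.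
  have [Pu Pv] := (sFP u Fu, sFP v Fv).
  have ZF w : w \in 'Phi(P) -> coset U w \in 'Z(P / U).
    by rewrite -Phi_quotient_center; apply: mem_quotient.
  have Pq t : t \in P -> coset U t \in P / U by apply: mem_quotient.
  rewrite /c (pair_autR maxP) // [LHS]morphR ?nU ?aP //= ax ay.
  rewrite [coset _ (_ * u)]morphM ?[coset _ (_ * v)]morphM ?nU ?groupX //=.
  rewrite (commg_mulZ (G := P / U)) ?ZF ?Pq ?groupX //.
  rewrite [coset _ (x ^+ l)]morphX ?[coset _ (y ^+ l)]morphX ?nU //=.
  rewrite [RHS]morphX ?nU //= morphR ?nU //=.
  have /centerP[_ cZ] := ZF c Fc; rewrite /c [coset _ _]morphR ?nU //= in cZ.
  by rewrite commXXg //; apply/commute_sym/cZ/Pq.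
(* Modulo [W], the error [s] of [a c] is central, and the Frattini error of [a z] commutes with
   powers of [c] since ['Phi(P) / W] is abelian. *)
have aT1 : coset W (a T) = coset W T ^+ (l * l * l).
  have [s Us ac'] := ac; have [w Fw az] := al z Pz.
  have [Ps Pw] := (sUP s Us, sFP w Fw).
  rewrite /T (pair_autR maxP) // [LHS]morphR ?nW ?aP //= ac' az.
  rewrite [coset _ (_ * s)]morphM ?nW ?groupX //= -[coset _ (z ^+ l * w)]mulg1.
  have Zs : coset W s \in 'Z(G) by rewrite (subsetP sVZ) ?mem_quotient.
  rewrite (commg_mulZ (G := G)) ?Gq ?groupM ?groupX ?group1 //.
  rewrite [coset _ (_ * w)]morphM ?nW ?groupX // commgMJ.
  have -> : [~ coset W (c ^+ (l * l)), coset W w] = 1.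
    apply/eqP/commgP; apply: (centsP Phi_quotient_abelian); rewrite mem_quotient //.
    exact: groupX.
  have TE : coset W T = [~ coset W c, coset W z] by rewrite [LHS]morphR ?nW.
  have /centerP[_ cT] := ZT.
  rewrite mul1g [coset _ (c ^+ _)]morphX ?nW //= [coset _ (z ^+ _)]morphX ?nW //=.
  rewrite commXXg; try by rewrite -TE; apply/commute_sym/cT/Gq.
  by rewrite -TE conjXg; congr (_ ^+ _); apply/conjg_fixP/commgP/cT/Gq.
(* Modulo [W], [T] is the p-th power of some [g], and [phi] kills the Frattini error of [a g]. *)
have aT2 : coset W (a T) = coset W T ^+ l.
  have : coset W T \in phi @* P by rewrite coset_pow_im.
  case/morphimP=> g _ Pg Tg; rewrite Tg -morphX //.
  have [r Wr Tr] : exists2 r, r \in W & T = g ^+ p * r.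
    by apply: coset_eq_mul; rewrite ?nW ?groupX.
  have War : a r \in W by apply: (pair_aut_char maxP (pcen_char (Mho_char 1 P))).
  have [Pr Par] := (sWP r Wr, sWP _ War).
  have -> : coset W (a T) = phi (a g).
    rewrite Tr (pair_autM maxP) ?groupX // (pair_autX maxP) //.
    by rewrite [LHS]morphM ?nW ?groupX ?aP //= [coset _ (a r)]coset_id ?mulg1.
  have [u Fu ->] := al g Pg; have Pu := sFP u Fu.
  have phiu : phi u = 1 by apply/set1gP; rewrite -coset_pow_Phi mem_morphim.
  by rewrite [LHS]morphM ?groupX // [mfun phi u]phiu mulg1.
have ntT : coset W T != 1.
  by apply: contra nWT => /eqP; apply: coset_idr; apply: nW.
have oT : #[coset W T] = p.
  by apply: nt_prime_order => //; apply: (pcen_exp pP (Mho_char 1 P)).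
have /eqP := aT2; rewrite aT1 eq_expg_mod_order oT.
have l_gt0 : 0 < l.
  by rewrite lt0n; apply: contraL cop_l => /eqP->; rewrite /coprime gcdn0 gtn_eqF ?prime_gt1.
rewrite eqn_mod_dvd; last by rewrite leq_pmull ?muln_gt0 ?l_gt0.
have -> : (l * l * l - l = l * (l.-1 * l.+1))%N.
  by case: (l) l_gt0 => [|m] //= _; clear; lia.
rewrite !Euclid_dvdM // => /or3P[| |//].
  by rewrite -[_ %| _]negbK -prime_coprime // cop_l.
by rewrite -subn1 -eqn_mod_dvd // (negPf l1).
Qed.

Lemma nonpowerful_Mho1 : U = 1.
Proof.
apply/eqP; apply: contraT => ntU; have p_gt1 := prime_gt1 pr_p.
have [l [l1 lq cop_l al]] := pair_scalar_mul pr_p pr_q maxP.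
have p_l := nonpowerful_eigenvalue ntU l1 cop_l al.
have l_gt0 : 0 < l.
  by rewrite lt0n; apply: contraL cop_l => /eqP->; rewrite /coprime gcdn0 gtn_eqF.
(* Now l^2 = 1 mod p, so an odd q would give l = l^q = 1 mod p. *)
have q2 : q = 2.
  have [// | odd_q] := even_prime pr_q; case/eqP: l1; rewrite -lq.
  rewrite -(odd_double_half q) odd_q add1n expnS -mul2n expnM.
  have ll : l ^ 2 = 1 %[mod p].
    apply/eqP; rewrite eqn_mod_dvd ?expn_gt0 ?l_gt0 //.
    by rewrite -[X in _ - X](exp1n 2) subn_sqr addn1 dvdn_mull.
  by rewrite -modnMmr -modnXm ll modnXm exp1n modnMmr muln1.
have aa x : a (a x) = x.
  by rewrite -permM -[(a * a)%g]/(a ^+ 2) -q2 -(maximal_pair_order maxP) expg_order perm1.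
have aP := pair_aut_closed maxP.
(* Inversion written as a power, with n = |P| - 1; n = 1 mod p would make p divide 2. *)
have [n [n1 nV]] : exists n, n != 1 %[mod p] /\ {in P, forall x, x ^+ n = x^-1}.
  exists #|P|.-1; split=> [|x Px]; last first.
    by apply/eqP; rewrite eq_sym eq_invg_mul -expgS prednK ?cardG_gt0 // expg_cardG.
  have ntP : P :!=: 1 by apply: contra (pair_not_cyclic maxP) => /eqP->; apply: cyclic1.
  have [_ p_P _] := pgroup_pdiv pP ntP.
  have P_gt1 : 1 < #|P| := leq_trans p_gt1 (dvdn_leq (cardG_gt0 P) p_P).
  have P1_gt0 : 0 < #|P|.-1 by rewrite -subn1 subn_gt0.
  rewrite eqn_mod_dvd //; apply: contraL (p_gt3) => p_P2; rewrite -leqNgt.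
  have : p %| 2.
    by rewrite -(dvdn_addr _ p_P2) subn1 addn2 prednK // prednK ?cardG_gt0.
  by move/dvdn_leq => /(_ isT) /leq_trans; apply.
have inverted x : x \in P -> a (x * (a x)^-1) = (x * (a x)^-1) ^+ n.
  move=> Px; have Pax := aP x Px; rewrite nV ?groupM ?groupV //.
  by rewrite (pair_autM maxP) ?groupV // (pair_autV maxP) // aa invMg invgK.
have [x [y [Px Py genP]]] := pair_gen2 maxP.
(* As [a] is an involution it inverts every [h t], and [h t] is congruent to [t ^+ 2] modulo
   ['Phi(P)]. With p odd, [h x] and [h y] therefore generate P. *)
pose h t := t * (a t)^-1.
have Ph t : t \in P -> h t \in P by move=> Pt; rewrite groupM ?groupV ?aP.
have nF := normal_norm (Phi_normal P).
have nFs := subsetP nF.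
have gen_h t : t \in P -> t \in 'Phi(P) <*> <[h t]>.
  move=> Pt; have Pht := Ph t Pt.
  have [u Fu at_] := al t Pt.
  pose X := coset 'Phi(P) t.
  have hX : coset 'Phi(P) (h t) = X ^+ 2.
    have Pu := subsetP (Phi_sub P) u Fu.
    rewrite [LHS]morphM ?groupV ?nFs ?aP //= [coset _ _^-1]morphV ?nFs ?aP //= at_.
    rewrite [coset _ (_ * u)]morphM ?groupX ?nFs //= [coset _ u]coset_id // mulg1.
    rewrite [coset _ (_ ^+ l)]morphX ?nFs //= -/X.
    suff -> : (X ^+ l)^-1 = X by rewrite expgS expg1.
    apply/eqP; rewrite eq_invg_mul -expgSr.
    have [m ->] := dvdnP p_l; rewrite mulnC expgM.
    have /abelemP[//| _ ->] := Phi_quotient_abelem pP; first by rewrite expg1n.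
    exact: mem_quotient.
  have cop : coprime #[X] 2.
    apply: (@pnat_coprime p).
      by apply: mem_p_elt (quotient_pgroup _ pP) _; apply: mem_quotient.
    by rewrite p'natE // dvdn_prime2 // gtn_eqF // ltnW.
  have [m Xm] := cycle_expg_coprime cop.
  have [u' Fu' tE] : exists2 u', u' \in 'Phi(P) & t = h t ^+ m * u'.
    apply: coset_eq_mul; rewrite ?nFs ?groupX //.
    by rewrite [RHS]morphX ?nFs //= hX -Xm.
  by rewrite {1}tE groupM ?groupX // mem_gen // inE ?Fu' ?cycle_id ?orbT.
have genh : <<[set h x; h y]>> = P.
  apply: Phi_nongen; apply/eqP; rewrite eqEsubset join_subG Phi_sub subUset !sub1set !Ph //=.
  rewrite -{1}genP gen_subG subUset !sub1set.
  have sub t : t \in [set x; y] -> 'Phi(P) <*> <[h t]> \subset 'Phi(P) <*> [set h x; h y].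
    move=> xyt; rewrite join_subG joing_subl cycle_subG mem_gen // inE orbC.
    by case/set2P: xyt => ->; rewrite ?set21 ?set22.
  by rewrite (subsetP (sub x _) _ (gen_h x Px)) ?(subsetP (sub y _) _ (gen_h y Py)) ?set21 ?set22.
case/eqP: ntU.
apply: (eigen_gen_Mho1_trivial pr_p pr_q maxP p_gt3 n1 (Ph x Px) (Ph y Py)) => //;
  try exact: inverted.
  exact: lcn3_sub_Mho1.
move=> u v Pu Pv au av; rewrite !(pair_autM maxP) ?groupM // au av !nV ?groupM //.
by rewrite !invMg mulgA.
Qed.

Lemma nonpowerful_extraspecial : [/\ extraspecial P, #|P| = (p ^ 3)%N & exponent P = p].
Proof.
have U1 := nonpowerful_Mho1; have [_ oQ] := quotient_Mho1_extraspecial.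
have oP : #|P| = (p ^ 3)%N.
  by rewrite -oQ U1; apply: card_isog (quotient1_isog P).
have ncP : ~~ abelian P.
  by apply: contra not_sDU => /derG1P->; apply: sub1G.
split=> //; first by apply: (p3group_extraspecial pP ncP); rewrite oP pfactorK.
have xp1 x : x \in P -> x ^+ p = 1.
  by move=> Px; apply/set1gP; rewrite -U1 (pow_Mho1 pP).
have /trivgPn[x Px ntx] : P :!=: 1 by apply: contra ncP => /eqP->; apply: abelian1.
apply/eqP; rewrite eqn_dvd; apply/andP; split; first exact/exponentP.
by rewrite -(nt_prime_order pr_p (xp1 x Px) ntx) dvdn_exponent.
Qed.

End Nonpowerful.

(** * The dichotomy on whether the derived subgroup lies in the subgroup of p-th powers *)

Theorem proposition5p3 (p q : nat) (gT : finGroupType) (P : {group gT})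
    (alpha : {perm gT}) (pr_p : prime p) (pr_q : prime q)
    (maxP : maximal_pair p q 2 P alpha) (p_gt3 : 3 < p) :
  (p.-abelem P /\ #|P| = (p ^ 2)%N) \/
  [/\ extraspecial P, #|P| = (p ^ 3)%N & exponent P = p].
Proof.
have [sDU | not_sDU] := boolP (P^`(1) \subset 'Mho^1(P)).
  left; apply: (abelian_pair pr_p pr_q maxP p_gt3).
  exact: powerful_pair_abelian pr_p pr_q maxP p_gt3 sDU.
right; exact: nonpowerful_extraspecial pr_p pr_q maxP p_gt3 not_sDU.
Qed.
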